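(* Let $n\ge 1$ and let $s_k,y_k\in\mathbb{R}^n$ with $y_k\neq 0$. Put $\alpha^{BB1}_{k+1}=\frac{s_k^Ty_k}{y_k^Ty_k}$ and suppose $\alpha^{BB1}_{k+1}>0$ (so that $s_k^Ty_k>0$). Put $$\alpha^{BB2}_{k+1}=\frac{s_k^Ts_k}{s_k^Ty_k},\qquad \alpha^{BB3}_{k+1}=\frac{s_k^Ts_k-y_k^Ty_k+\sqrt{(y_k^Ty_k-s_k^Ts_k)^2+4(s_k^Ty_k)^2}}{2\,s_k^Ty_k}.$$ Then $$\alpha^{BB3}_{k+1}=\frac{\alpha^{BB2}_{k+1}-\frac{1}{\alpha^{BB1}_{k+1}}+\sqrt{\left(\frac{1}{\alpha^{BB1}_{k+1}}-\alpha^{BB2}_{k+1}\right)^2+4}}{2}.$$ Moreover, $$\alpha^{BB1}_{k+1}\le\alpha^{BB3}_{k+1}\le\alpha^{BB2}_{k+1},$$ and $$\lim_{\alpha^{BB1}_{k+1}\to\infty}\frac{\alpha^{BB3}_{k+1}}{\alpha^{BB2}_{k+1}}=1,\qquad \lim_{\alpha^{BB2}_{k+1}\to 0}\frac{\alpha^{BB3}_{k+1}}{\alpha^{BB1}_{k+1}}=1,$$ where the limits are taken as the pair $(s_k,y_k)$ varies over all pairs of vectors in $\mathbb{R}^n$ with $s_k^Ty_k>0$ (that is, for every $\varepsilon>0$ there is $M>0$ such that $|\alpha^{BB3}_{k+1}/\alpha^{BB2}_{k+1}-1|<\varepsilon$ whenever $\alpha^{BB1}_{k+1}>M$, and there is $\delta>0$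 such that $|\alpha^{BB3}_{k+1}/\alpha^{BB1}_{k+1}-1|<\varepsilon$ whenever $0<\alpha^{BB2}_{k+1}<\delta$).
   Context: In the gradient descent method $x_{k+1}=x_k-\alpha_kg_k$, where $g_k$ is the gradient of the objective function at the iterate $x_k\in\mathbb{R}^n$, one sets $s_k=x_{k+1}-x_k$ and $y_k=g_{k+1}-g_k$. The quantities $\alpha^{BB1}_{k+1}$ and $\alpha^{BB2}_{k+1}$ are the two classical Barzilai-Borwein steplengths, and $\alpha^{BB3}_{k+1}$ is the new steplength, obtained from the total least squares problem $\min_{\alpha}\frac{\|\alpha y_k-s_k\|^2}{\alpha^2+1}$. All three depend only on the vectors $s_k,y_k$, through the formulas given in the claim. $\|\cdot\|$ is the Euclidean norm. *)

(* Defs.v *)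
From HB Require Import structures.
From mathcomp Require Import all_boot all_order all_algebra.
From mathcomp Require Import reals.

Set Implicit Arguments.
Unset Strict Implicit.
Unset Printing Implicit Defensive.

Import Order.TTheory GRing.Theory Num.Theory.
Local Open Scope ring_scope.

Definition dot (R : realType) (n : nat) (u v : 'cV[R]_n) : R :=
  (u^T *m v) 0 0.

Definition bb1 (R : realType) (n : nat) (s y : 'cV[R]_n) : R :=
  dot s y / dot y y.

Definition bb2 (R : realType) (n : nat) (s y : 'cV[R]_n) : R :=
  dot s s / dot s y.

(* For [0 < dot s y], the larger root of
   [dot s y * t ^+ 2 - (dot s s - dot y y) * t - dot s y], which is the
   minimizer over t of |t y - s|^2 / (t^2 + 1). *)
Definition bb3 (R : realType) (n : nat) (s y : 'cV[R]_n) : R :=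
  (dot s s - dot y y
     + Num.sqrt ((dot y y - dot s s) ^+ 2 + 4 * dot s y ^+ 2))
  / (2 * dot s y).

(* Main.v *)
Require Import Defs.
From HB Require Import structures.
From mathcomp Require Import all_boot all_order all_algebra.
From mathcomp Require Import reals.
From mathcomp Require Import ring lra.

Set Implicit Arguments.
Unset Strict Implicit.
Unset Printing Implicit Defensive.

Import Order.TTheory GRing.Theory Num.Theory.
Local Open Scope ring_scope.

(** Write [x = bb1 s y], [z = bb2 s y] and [t = bb3 s y], with [0 < dot s y].
    Dividing the formula for [t] by [dot s y], and moving this positive factor
    under the square root, shows that [t] depends on [x] and [z] alone: it is
    the positive root of [t ^+ 2 - (z - x^-1) * t - 1], the roots of which have
    product [-1] ([bb3E]).  That quadratic equation can be rewritten as
    [x * t * (z - t) = t - x] ([posroot_balance]): the gaps [z - t] and [t - x]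
    have the same sign.  Cauchy-Schwarz gives [x <= z], so the gaps have a
    nonnegative sum, hence both are nonnegative and [x <= t <= z].

    The same identity quantifies both limits.  Since [t - x <= t], the gap
    [z - t] is at most [x^-1], and [z >= x] gives [1 - t / z <= x ^- 2], which
    tends to 0 as [x] grows.  Symmetrically, [t / x - 1 = t * (z - t)] is at
    most [z ^+ 2], which tends to 0 with [z]. *)

(** * The inner product *)

Section Dot.
Variables (R : realType) (n : nat).
Implicit Types s y : 'cV[R]_n.

Lemma dotE s y : dot s y = \sum_i s i 0 * y i 0.
Proof. by rewrite /dot mxE; apply: eq_bigr => i _; rewrite mxE. Qed.

Lemma dot_ge0 s : 0 <= dot s s.
Proof. by rewrite dotE sumr_ge0 // => i _; rewrite -expr2 sqr_ge0. Qed.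

Lemma dot_self_eq0 s : dot s s = 0 -> s = 0.
Proof.
rewrite dotE => /eqP; rewrite psumr_eq0 => [/allP s0|i _]; last first.
  by rewrite -expr2 sqr_ge0.
apply/colP => i; have := s0 i (mem_index_enum i).
by rewrite mulf_eq0 orbb mxE => /eqP.
Qed.

Lemma dot_lincomb (l m : R) s y :
  dot (l *: s - m *: y) (l *: s - m *: y)
  = l ^+ 2 * dot s s - 2 * l * m * dot s y + m ^+ 2 * dot y y.
Proof.
rewrite !dotE !mulr_sumr -sumrB -big_split /=.
by apply: eq_bigr => i _; rewrite !mxE; ring.
Qed.

Lemma cauchy_schwarz s y : dot s y ^+ 2 <= dot s s * dot y y.
Proof.
have [yy0|yy_neq0] := eqVneq (dot y y) 0.
  by rewrite (dot_self_eq0 yy0) /dot !mulmx0 mxE expr0n mulr0.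
have yy_gt0 : 0 < dot y y by rewrite lt_def yy_neq0 dot_ge0.
(* Up to the factor [dot y y], the vector below is the component of [s]
   orthogonal to [y]. *)
have := dot_ge0 (dot y y *: s - dot s y *: y).
rewrite dot_lincomb => residual_ge0.
rewrite -subr_ge0 -(pmulr_rge0 _ yy_gt0).
by move: residual_ge0; congr (0 <= _); ring.
Qed.

Lemma dot_gt0 s y : 0 < dot s y -> 0 < dot s s /\ 0 < dot y y.
Proof.
move=> sy_gt0; have := lt_le_trans (exprn_gt0 2 sy_gt0) (cauchy_schwarz s y).
by move=> prod_gt0; have := dot_ge0 s; have := dot_ge0 y; split; nra.
Qed.

End Dot.

(** * The positive root of [t ^+ 2 - d * t - 1] *)

Section PosRoot.
Variable R : realType.
Implicit Types d x z : R.

Definition posroot d : R := (d + Num.sqrt (d ^+ 2 + 4)) / 2.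

Lemma posroot_gt0 d : 0 < posroot d.
Proof.
rewrite divr_gt0 //.
have h : 0 < d ^+ 2 + 4 by have := sqr_ge0 d; lra.
have := sqr_sqrtr (ltW h); have : 0 < Num.sqrt (d ^+ 2 + 4) by rewrite sqrtr_gt0.
by nra.
Qed.

Lemma posroot_eq d : posroot d ^+ 2 = d * posroot d + 1.
Proof.
have h : 0 <= d ^+ 2 + 4 by have := sqr_ge0 d; lra.
by have := sqr_sqrtr h; rewrite /posroot; move: (Num.sqrt _) => r; nra.
Qed.

(** The defining quadratic in a form that ties the sign and the size of the gap
    to [z] to those of the gap to [x]. *)
Lemma posroot_balance x z (t := posroot (z - 1 / x)) :
  0 < x -> x * t * (z - t) = t - x.
Proof.
move=> x_gt0.
have -> : x * t * (z - t) = x * (z * t - t ^+ 2) by ring.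
by rewrite /t posroot_eq; field; rewrite gt_eqF.
Qed.

Lemma posroot_bounds x z (t := posroot (z - 1 / x)) :
  0 < x -> x <= z -> x <= t <= z.
Proof.
move=> x_gt0 le_xz; have := posroot_balance z x_gt0; rewrite -/t.
have xt_gt0 : 0 < x * t by rewrite mulr_gt0 // posroot_gt0.
by move: (x * t) xt_gt0 => c c_gt0 balance; apply/andP; split; nra.
Qed.

(** Since [t - x <= t], the balance identity gives [z - t <= x^-1]; the second
    factor [x^-1] of the bound comes from dividing by [z >= x]. *)
Lemma posroot_upper_gap x z (t := posroot (z - 1 / x)) :
  0 < x -> x <= z -> `|t / z - 1| <= x ^- 2.
Proof.
move=> x_gt0 le_xz; have z_gt0 := lt_le_trans x_gt0 le_xz.
have t_gt0 : 0 < t := posroot_gt0 _.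
have /andP[le_xt le_tz] : x <= t <= z by apply: posroot_bounds.
have gap_le : x * (z - t) <= 1.
  have : x * t * (z - t) = t - x := posroot_balance z x_gt0.
  by rewrite -(ler_pM2r t_gt0); lra.
rewrite distrC ger0_norm; last by rewrite subr_ge0 ler_pdivrMr ?mul1r.
have -> : 1 - t / z = (z - t) / z by field; rewrite gt_eqF.
rewrite ler_pdivrMr // mulrC ler_pdivlMr ?exprn_gt0 //.
by nra.
Qed.

(** By the balance identity [t / x - 1 = t * (z - t)], and both factors lie
    between 0 and [z]. *)
Lemma posroot_lower_gap x z (t := posroot (z - 1 / x)) :
  0 < x -> x <= z -> `|t / x - 1| <= z ^+ 2.
Proof.
move=> x_gt0 le_xz; have t_gt0 : 0 < t := posroot_gt0 _.
have /andP[le_xt le_tz] : x <= t <= z by apply: posroot_bounds.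
rewrite ger0_norm; last by rewrite subr_ge0 ler_pdivlMr ?mul1r.
have -> : t / x - 1 = (t - x) / x by field; rewrite gt_eqF.
have <- : x * t * (z - t) = t - x := posroot_balance z x_gt0.
have -> : x * t * (z - t) / x = t * (z - t) by field; rewrite gt_eqF.
by nra.
Qed.

End PosRoot.

(** * The steplengths *)

Section Steplengths.
Variables (R : realType) (n : nat).
Implicit Types s y : 'cV[R]_n.

Lemma bb1_gt0_dot s y : 0 < bb1 s y -> 0 < dot s y.
Proof.
rewrite /bb1 => x_gt0; have := dot_ge0 y.
rewrite le_eqVlt => /predU1P[yy0|yy_gt0].
  by move: x_gt0; rewrite -yy0 invr0 mulr0 ltxx.
by move: x_gt0; rewrite pmulr_lgt0 // invr_gt0.
Qed.

Lemma bb1_gt0 s y : 0 < dot s y -> 0 < bb1 s y.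
Proof. by move=> sy; have [_ yy] := dot_gt0 sy; rewrite divr_gt0. Qed.

Lemma bb1_le_bb2 s y : 0 < dot s y -> bb1 s y <= bb2 s y.
Proof.
move=> sy_gt0; have [ss_gt0 yy_gt0] := dot_gt0 sy_gt0.
rewrite /bb1 /bb2 ler_pdivrMr // mulrAC ler_pdivlMr // -expr2.
exact: cauchy_schwarz.
Qed.

(** Reduces [bb3] to a function of [bb1] and [bb2] alone: with
    [d = bb2 s y - 1 / bb1 s y = (dot s s - dot y y) / dot s y], the radicand is
    [dot s y ^+ 2 * (d ^+ 2 + 4)]. *)
Lemma bb3E s y : 0 < dot s y -> bb3 s y = posroot (bb2 s y - 1 / bb1 s y).
Proof.
move=> sy_gt0; have [_ yy_gt0] := dot_gt0 sy_gt0.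
rewrite /bb3 /posroot /bb1 /bb2.
set a := dot s s; set b := dot y y in yy_gt0 *; set p := dot s y in sy_gt0 *.
have p_neq0 : p != 0 by rewrite gt_eqF.
have -> : a / p - 1 / (p / b) = (a - b) / p by field; rewrite p_neq0 gt_eqF.
have -> : (b - a) ^+ 2 + 4 * p ^+ 2 = p ^+ 2 * (((a - b) / p) ^+ 2 + 4).
  by field.
rewrite sqrtrM ?sqr_ge0 // sqrtr_sqr gtr0_norm //.
by move: (Num.sqrt _) => r; field.
Qed.

End Steplengths.

Theorem theorem1 (R : realType) (n : nat) (hn : (1 <= n)%N) :
  (forall s y : 'cV[R]_n, y != 0 -> 0 < bb1 s y ->
     bb3 s y = (bb2 s y - 1 / bb1 s y
                + Num.sqrt ((1 / bb1 s y - bb2 s y) ^+ 2 + 4)) / 2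
     /\ bb1 s y <= bb3 s y
     /\ bb3 s y <= bb2 s y)
  /\ (forall eps : R, 0 < eps ->
        exists M : R, 0 < M /\
          forall s y : 'cV[R]_n, 0 < dot s y -> M < bb1 s y ->
            `|bb3 s y / bb2 s y - 1| < eps)
  /\ (forall eps : R, 0 < eps ->
        exists delta : R, 0 < delta /\
          forall s y : 'cV[R]_n, 0 < dot s y ->
            0 < bb2 s y -> bb2 s y < delta ->
            `|bb3 s y / bb1 s y - 1| < eps).
Proof.
split; [|split].
- move=> s y _ x_gt0; have sy_gt0 := bb1_gt0_dot x_gt0.
  rewrite bb3E //; split; first by rewrite /posroot -[in RHS]sqrrN opprB.
  by apply/andP/posroot_bounds => //; exact: bb1_le_bb2.
- move=> eps eps_gt0; have inv_gt0 : 0 < eps^-1 by rewrite invr_gt0.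
  (* The summand 1 ensures [x <= x ^+ 2] for [x > M]. *)
  exists (1 + eps^-1); split=> [|s y sy_gt0 x_gtM]; first by lra.
  have x_gt0 := bb1_gt0 sy_gt0.
  rewrite bb3E //; apply: le_lt_trans (posroot_upper_gap x_gt0 _) _.
    exact: bb1_le_bb2.
  by rewrite invf_plt ?posrE ?exprn_gt0 //; nra.
- move=> eps eps_gt0.
  (* The bound by 1 ensures [z ^+ 2 <= z] for [0 < z < delta]. *)
  exists (Num.min 1 eps); split=> [|s y sy_gt0 z_gt0].
    by rewrite lt_min ltr01.
  rewrite lt_min => /andP[z_lt1 z_lt_eps].
  rewrite bb3E //; apply: le_lt_trans (posroot_lower_gap (bb1_gt0 sy_gt0) _) _.
    exact: bb1_le_bb2.
  by nra.
Qed.
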